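(* Let $\mathcal{S}$ be a commutative semigroup, and let $a\in\mathcal{S}^{\bullet}$ be an element with $\Psi(a)$ finite. If $|H_a|$ is infinite, then $\mathrm{D}_a(\mathcal{S})$ is infinite. If $|H_a|$ is finite, then $\mathrm{D}_a(\mathcal{S})$ is finite and $$\epsilon\,\mathrm{D}(\Gamma(H_a))\ \leq\ \mathrm{D}_a(\mathcal{S})\ \leq\ \Psi(a)+\mathrm{D}(\Gamma(H_a))-1,$$ where $\epsilon=\frac12$ if $(a+a)\ \mathcal{H}\ a$, and $\epsilon=1$ otherwise. Moreover, both the lower and the upper bounds are sharp: for each of the two cases $\epsilon=\frac12$ and $\epsilon=1$ there exist a commutative semigroup $\mathcal{S}$ and an element $a\in\mathcal{S}^{\bullet}$ in that case, with $\Psi(a)$ and $|H_a|$ finite, such that $\mathrm{D}_a(\mathcal{S})=\epsilon\,\mathrm{D}(\Gamma(H_a))$; and there exist a commutative semigroup $\mathcal{S}$ and an element $a\in\mathcal{S}^{\bullet}$, with $\Psi(a)$ and $|H_a|$ finite, such that $\mathrm{D}_a(\mathcal{S})=\Psi(a)+\mathrm{D}(\Gamma(H_a))-1$.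
   Context: Commutative semigroups $\mathcal{S}$ are written additively. The identity element of $\mathcal{S}$, if it exists, is denoted $0_{\mathcal{S}}$, and then $\mathcal{S}$ is called a monoid. $\mathcal{S}^0=\mathcal{S}$ if $\mathcal{S}$ has an identity; otherwise $\mathcal{S}^0=\mathcal{S}\cup\{0\}$ is obtained by adjoining an identity. $\mathcal{S}^{\bullet}$ is $\mathcal{S}^0$ with its identity element removed (so $\mathcal{S}^\bullet\subseteq\mathcal{S}$). A sequence over $\mathcal{S}$ is a finite multiset $T$ of elements of $\mathcal{S}$ (an element of the free commutative monoid $\mathcal{F}(\mathcal{S})$), $|T|$ is its length (number of terms with multiplicity), and $\sigma(T)$ is the sum of its terms. If $\mathcal{S}$ is a monoid, the empty sequence is allowed and has sum $0_{\mathcal{S}}$; if $\mathcal{S}$ has no identity, the empty sequence has no sum. $T$ is reducible if it has a proper subsequence $T'\neq T$ with $\sigma(T')=\sigma(T)$ (the empty one being considered only when $\mathcal{S}$ is a monoid), and irreducible otherwise. For $a\in\mathcal{S}^\bullet$, $\mathrm{D}_a(\mathcal{S})\in\mathbb{N}\cup\{\infty\}$ is the largest length (supremum of lengths) of irreducible sequences $T$ over $\mathcal{S}$ with $\sigma(T)=a$. For an abelian group $G$, $\mathrm{D}(G)$ is the Davenport constant: the smallest $\ell\in\mathbb{N}\cup\{\infty\}$, with $\mathbb{N}=\{1,2,\dots\}$, such that every sequence over $G$ of length at least $\ell$ has a nonempty subsequence with sum $0_G$ (equivalently, is reducible). For $a\in\mathcal{S}^0$, $(a)=\{a+c:c\in\mathcal{S}^0\}$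 is the principal ideal generated by $a$. Green's preorder: $a\leqq_{\mathcal{H}}b$ iff $(a)\subseteq(b)$; Green's congruence: $a\ \mathcal{H}\ b$ iff $(a)=(b)$; $H_a$ is the $\mathcal{H}$-class of $a$. $\Psi(a)\in\mathbb{N}_0\cup\{\infty\}$ is the largest $\ell$ (supremum) for which there exist $a_1,\dots,a_\ell\in\mathcal{S}^0$ with $(a)\subsetneq(a_1)\subsetneq\cdots\subsetneq(a_\ell)$. Schützenberger group: let $\mathrm{St}(H_a)=\{c\in\mathcal{S}^0: c+x\in H_a\text{ for every }x\in H_a\}$. Each $c\in\mathrm{St}(H_a)$ induces a map $\gamma_c:H_a\to H_a$, $x\mapsto c+x$. Then $\Gamma(H_a)=\{\gamma_c:c\in\mathrm{St}(H_a)\}$, with operation $\gamma_c+\gamma_d=\gamma_{c+d}$ (composition), is an abelian group. *)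

(* Defs.v *)
From HB Require Import structures.
From mathcomp Require Import all_boot all_order all_algebra.
From mathcomp Require Import finmap multiset.
From mathcomp Require Import all_classical all_reals ereal.
Set Implicit Arguments.
Unset Strict Implicit.
Unset Printing Implicit Defensive.
Import Order.TTheory GRing.Theory Num.Theory.
Local Open Scope mset_scope.
Local Open Scope classical_set_scope.
Local Open Scope ring_scope.

(* A commutative semigroup is an [addSemigroupType]: a carrier with a
   commutative and associative addition, and no identity required. *)

Definition has_identity (S : addSemigroupType) : Prop :=
  exists e : S, left_id e +%R.

(* S^0 is the set of those elements of [option S] that are in S, together with
   [None] exactly when S has no identity; [None] is then the adjoined 0. *)
Definition in_adjoin0 (S : addSemigroupType) : pred (option S) :=
  fun u => isSome u || `[< ~ has_identity S >].

Definition adjoin0 (S : addSemigroupType) := {u : option S | in_adjoin0 u}.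

HB.instance Definition _ (S : addSemigroupType) := Choice.on (adjoin0 S).

Section Adjoin0.
Variable S : addSemigroupType.
Implicit Types u v w : option S.

Definition to_adjoin0 (x : S) : adjoin0 S := exist _ (Some x) isT.

Definition opt_add u v : option S :=
  match u, v with
  | Some x, Some y => Some (x + y)
  | Some _, None => u
  | None, _ => v
  end.

Lemma opt_add_in u v : in_adjoin0 u -> in_adjoin0 v -> in_adjoin0 (opt_add u v).
Proof. by case: u => [x|]; case: v. Qed.

Definition adjoin0_add (p q : adjoin0 S) : adjoin0 S :=
  exist _ (opt_add (val p) (val q)) (opt_add_in (valP p) (valP q)).

Definition opt_zero : option S :=
  if pselect (has_identity S) is left h then Some (projT1 (cid h)) else None.

Lemma opt_zero_in : in_adjoin0 opt_zero.
Proof.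
rewrite /opt_zero /in_adjoin0; case: pselect => //= h.
by apply/asboolP.
Qed.

Definition adjoin0_zero : adjoin0 S := exist _ opt_zero opt_zero_in.

Lemma adjoin0_addA : associative adjoin0_add.
Proof.
by move=> [[x|] ?] [[y|] ?] [[z|] ?]; apply: val_inj => //=; rewrite Algebra.addrA.
Qed.

Lemma adjoin0_addC : commutative adjoin0_add.
Proof. by move=> [[x|] ?] [[y|] ?]; apply: val_inj => //=; rewrite Algebra.addrC. Qed.

Lemma adjoin0_add0 : left_id adjoin0_zero adjoin0_add.
Proof.
move=> [u hu]; apply: val_inj; rewrite /= /opt_zero.
case: pselect => h //; case: u hu => [x|] /= hu.
  by case: (cid h) => e /= ->.
by move: hu => /asboolP.
Qed.

HB.instance Definition _ :=
  GRing.isNmodule.Build (adjoin0 S) adjoin0_addA adjoin0_addC adjoin0_add0.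

Lemma to_adjoin0D x y : to_adjoin0 (x + y) = to_adjoin0 x + to_adjoin0 y.
Proof. exact: val_inj. Qed.

Lemma to_adjoin0_eq0 x : (to_adjoin0 x = 0) <-> left_id x +%R.
Proof.
split=> [x0 y|xl].
  have : to_adjoin0 x + to_adjoin0 y = to_adjoin0 y by rewrite x0 add0r.
  by case.
apply: val_inj => /=; rewrite /opt_zero; case: pselect => [h|[]]; last by exists x.
by case: (cid h) => e /= el; rewrite -[x]el Algebra.addrC xl.
Qed.

End Adjoin0.

(* A sequence over S is a finite multiset of elements of S.  Its sum is taken in
   S^0, so that the empty sequence has a sum in S only if S is a monoid. *)
Definition seq_sum (S : addSemigroupType) (T : {mset S}) : adjoin0 S :=
  \sum_(x <- T) to_adjoin0 x.

Definition reducible (S : addSemigroupType) (T : {mset S}) : Prop :=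
  exists T' : {mset S},
    [/\ (T' `<` T)%mset, T' = mset0 -> has_identity S & seq_sum T' = seq_sum T].

Definition irreducible (S : addSemigroupType) (T : {mset S}) : Prop :=
  ~ reducible T.

(* The supremum and the minimum of a set of natural numbers, in the extended
   reals; [nat_inf set0] is [+oo]. *)
Definition nat_sup (R : realType) (A : set nat) : \bar R :=
  ereal_sup [set (n%:R)%:E | n in A].

Definition nat_inf (R : realType) (A : set nat) : \bar R :=
  ereal_inf [set (n%:R)%:E | n in A].

(* D_a(S), for a in S^0 other than 0. *)
Definition davenport_at (R : realType) (S : addSemigroupType) (a : adjoin0 S) :
    \bar R :=
  nat_sup R [set size T | T in [set T : {mset S} |
                                 irreducible T /\ seq_sum T = a]].

(* The Davenport constant D(G) of an abelian group. *)
Definition davenport (R : realType) (G : zmodType) : \bar R :=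
  nat_inf R [set l | (0 < l)%N /\ forall T : {mset G}, (l <= size T)%N ->
    exists T' : {mset G},
      [/\ (T' `<=` T)%mset, T' <> mset0 & \sum_(x <- T') x = 0]].

(* Ideals and Green's relations are defined in a commutative monoid M, which
   stands for S^0. *)
Section Green.
Variable M : nmodType.
Implicit Types a b c : M.

Definition principal a : set M := [set a + c | c in [set: M]].

Definition greenH a b : Prop := principal a = principal b.

Definition Hclass a : set M := [set x | greenH a x].

(* The chain (a) < (a_1) < ... < (a_l) is encoded by the list of the a_i. *)
Definition Psi (R : realType) a : \bar R :=
  nat_sup R [set size s | s in [set s : seq M |
    path (fun x y => `[< principal x `<` principal y >]) a s]].

Definition St a : set M := [set c | forall x, Hclass a x -> Hclass a (c + x)].

Definition is_translation a : pred (Hclass a -> Hclass a) :=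
  fun f => `[< exists2 c, St a c & forall x, val (f x) = c + val x >].

(* Gamma(H_a); the group law below is composition of maps. *)
Definition schutzenberger a := {f : Hclass a -> Hclass a | is_translation f}.

HB.instance Definition _ a := Choice.on (schutzenberger a).

Lemma greenHP a b : greenH a b <-> principal a b /\ principal b a.
Proof.
split=> [ab|[[c _ <-] [d _ e]]].
  by split; [rewrite ab|rewrite -ab]; exists 0 => //; rewrite addr0.
rewrite /greenH predeqE => x; split=> -[y _ <-].
  by exists (d + y) => //; rewrite addrA e.
by exists (c + y) => //; rewrite addrA.
Qed.

Section SchutzenbergerGroup.
Variable a : M.
Implicit Types f g : schutzenberger a.

Lemma schutz_zero_subproof : is_translation (@id (Hclass a)).
Proof.
apply/asboolP; exists 0 => [x|x]; last by rewrite add0r.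
by rewrite add0r.
Qed.

Definition schutz_zero : schutzenberger a := exist (@is_translation a) _ schutz_zero_subproof.

Lemma schutz_add_subproof f g : is_translation (val f \o val g).
Proof.
have [/asboolP[c Sc fc] /asboolP[d Sd gd]] := (valP f, valP g).
apply/asboolP; exists (c + d) => [x Hx|x] /=; last by rewrite fc gd addrA.
by rewrite -addrA; apply/Sc/Sd.
Qed.

Definition schutz_add f g : schutzenberger a :=
  exist (@is_translation a) _ (schutz_add_subproof f g).

Lemma schutz_addA : associative schutz_add.
Proof. by move=> f g h; apply: val_inj. Qed.

Lemma schutz_addC : commutative schutz_add.
Proof.
move=> [f hf] [g hg]; apply: val_inj; apply/funext => x; apply: val_inj => /=.
move: hf hg => /asboolP[c _ fc] /asboolP[d _ gd].
by rewrite fc gd gd fc addrCA.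
Qed.

Lemma schutz_add0 : left_id schutz_zero schutz_add.
Proof. by move=> f; apply: val_inj. Qed.

Lemma schutz_opp_subproof f : exists g, schutz_add g f = schutz_zero.
Proof.
case: f => f hf; have /asboolP[c Sc fc] := hf.
have /greenHP[_ [e _ eE]] : greenH a (c + a) by apply: Sc.
have inv x : Hclass a x -> c + (e + x) = x.
  move=> /greenHP[[y _ <-] _].
  by rewrite !addrA (addrAC c) eE.
have Se : St a e.
  move=> x Hx; apply: (etrans Hx); apply/greenHP.
  split; first by exists e => //; rewrite addrC.
  by exists c => //; rewrite addrC (inv _ Hx).
pose g (x : Hclass a) : Hclass a :=
  exist _ (e + val x) (mem_set (Se _ (set_mem (valP x)))).
have hg : is_translation g by apply/asboolP; exists e.
exists (exist (@is_translation a) g hg).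
apply: val_inj; apply/funext => x; apply: val_inj => /=.
by rewrite fc addrCA inv //; exact: set_mem (valP x).
Qed.

Definition schutz_opp f : schutzenberger a :=
  projT1 (cid (schutz_opp_subproof f)).

Lemma schutz_addN : left_inverse schutz_zero schutz_opp schutz_add.
Proof. by move=> f; rewrite /schutz_opp; case: cid. Qed.

HB.instance Definition _ := GRing.isZmodule.Build (schutzenberger a)
  schutz_addA schutz_addC schutz_add0 schutz_addN.

End SchutzenbergerGroup.

End Green.

Definition epsilon (R : realType) (M : nmodType) (a : M) : R :=
  if `[< greenH (a + a) a >] then 2^-1 else 1.

(* Main.v *)
(* Upper bound: in an irreducible T of sum a, add the terms one at a time, each
   strictly shrinking the principal ideal of the partial sum, until that sum lies
   in H_a. This takes at most Psi(a) terms. The remaining terms stabilise H_a and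
   give a zero-sum free sequence over Gamma(H_a), hence are fewer than
   D(Gamma(H_a)).

   Lower bound: let a sequence over Gamma(H_a) have no nonempty subsequence of sum
   0, nor of sum the class of a when a itself stabilises H_a. Lift it to S and add
   one term completing the sum to a; the result is irreducible. When a does not
   stabilise H_a, take a zero-sum free sequence of length D - 1. Otherwise, by
   maximality, such a sequence has a subsequence T_1 whose sum is the class of a,
   and T_1 minus one term and the negative of the rest of the sequence both
   qualify; the longer of the two has length at least D/2 - 1. If H_a is infinite,
   the sequence is built greedily and may be arbitrarily long.

   Sharpness: for S = Z/2 and S = N with a = 1, the two bounds meet, or leave room
   for a single value. *)
Require Import Defs.
From HB Require Import structures.
From mathcomp Require Import all_boot all_order all_algebra.
From mathcomp Require Import finmap multiset.
From mathcomp Require Import all_classical all_reals ereal.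
Set Implicit Arguments.
Unset Strict Implicit.
Unset Printing Implicit Defensive.
Import Order.TTheory GRing.Theory Num.Theory.
Local Open Scope mset_scope.
Local Open Scope classical_set_scope.
Local Open Scope ring_scope.

(** * Subsequences and finite multisets *)

Lemma subseq_map_inv (T U : eqType) (f : T -> U) (s : seq T) (w : seq U) :
  subseq w (map f s) -> exists2 v, subseq v s & w = map f v.
Proof.
move=> /subseqP[m _ ->]; exists (mask m s); first exact: mask_subseq.
by rewrite map_mask.
Qed.

Lemma subseq_compl (T : eqType) (w s : seq T) : subseq w s ->
  exists2 v, subseq v s & perm_eq s (w ++ v).
Proof.
elim: s w => [|x s IHs] w; first by rewrite subseq0 => /eqP ->; exists [::].
case: w => [_|y w]; first by exists (x :: s); rewrite ?subseq_refl.
rewrite [subseq (y :: w) _]/=; case: eqP => [->|_] /IHs[v vs ps].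
  by exists v; rewrite ?perm_cons // (subseq_trans vs) // subseq_cons.
exists (x :: v); first by rewrite /= eqxx.
by rewrite -[x :: v]cat1s perm_sym perm_catCA /= perm_cons perm_sym.
Qed.

Lemma perm_subseq (T : eqType) (s w v : seq T) : perm_eq s (w ++ v) ->
  exists2 u, subseq u s & perm_eq u w.
Proof.
move=> /permP ps.
have [|u us wu] := (count_subseqP w s).1; last by exists u; rewrite 1?perm_sym.
by move=> x; rewrite ps count_cat leq_addr.
Qed.

Lemma msubset_seq_mset (T : choiceType) (A : {mset T}) (s : seq T) :
  (A `<=` seq_mset s)%mset <-> exists2 w, subseq w s & perm_eq A w.
Proof.
split=> [/msubsetP As|/count_subseqP As].
  by apply/count_subseqP => x; rewrite count_mem_mset -mset_seqE.
by apply/msubsetP => x; rewrite -count_mem_mset mset_seqE.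
Qed.

Lemma size_seq_mset (T : choiceType) (s : seq T) : size (seq_mset s) = size s.
Proof. exact/perm_size/perm_eq_seq_mset. Qed.

Lemma seq_sum_seq_mset (S : addSemigroupType) (s : seq S) :
  seq_sum (seq_mset s) = \sum_(x <- map (@to_adjoin0 S) s) x.
Proof. by rewrite big_map; apply: perm_big; exact: perm_eq_seq_mset. Qed.

(** Since a <> 0, a subsequence of sum a is nonempty and so meets the proviso in [reducible]; it is
    proper exactly when it is shorter. *)
Lemma irreducibleP (S : addSemigroupType) (a : adjoin0 S) (s : seq S) :
  a <> 0 -> seq_sum (seq_mset s) = a ->
  irreducible (seq_mset s) <->
  forall w, subseq w (map (@to_adjoin0 S) s) -> \sum_(x <- w) x = a ->
    (size s <= size w)%N.
Proof.
move=> a0 sa; split=> [irr w /subseq_map_inv[v vs ->] va|irr [T' [T's _ T'a]]].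
  rewrite size_map leqNgt; apply/negP => vlts; apply: irr.
  exists (seq_mset v); split.
  - rewrite mproperEneq; apply/andP; split.
      apply: contraTneq vlts => /(congr1 (fun A : {mset S} => size A)).
      by rewrite !size_seq_mset => ->; rewrite ltnn.
    by apply/msubset_seq_mset; exists v => //; exact: perm_eq_seq_mset.
  - move=> v0; case: a0; rewrite -va -seq_sum_seq_mset v0.
    by rewrite /seq_sum big_mset0.
  - by rewrite sa seq_sum_seq_mset.
have /msubset_seq_mset[w ws T'w] := mproper_sub T's.
have T'E : T' = seq_mset w.
  by rewrite -[LHS]seq_mset_id; exact/eq_seq_msetP.
have := mproper_neq T's; rewrite T'E; apply/negP; rewrite negbK.
apply/eqP; congr seq_mset; apply/eqP; rewrite -(size_subseq_leqif ws).
rewrite eqn_leq size_subseq //= -(size_map (@to_adjoin0 S) w).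
by apply: irr; rewrite ?map_subseq // -seq_sum_seq_mset -T'E T'a.
Qed.

(** * Principal ideals and the Schutzenberger group *)

Section GreenTheory.
Variable M : nmodType.
Implicit Types (a b c x y : M).

Lemma principalP a b : principal a b <-> exists c, b = a + c.
Proof. by split=> [[c _ <-]|[c ->]]; [exists c|exists c]. Qed.

Lemma subset_principal a b : principal a `<=` principal b <-> principal b a.
Proof.
split=> [|[c _ <-] _ [d _ <-]]; first by apply; exists 0 => //; rewrite addr0.
by exists (c + d) => //; rewrite addrA.
Qed.

Lemma greenH_addr a b c : greenH a b -> greenH (a + c) (b + c).
Proof.
move=> /greenHP[/principalP[d bE] /principalP[e aE]]; apply/greenHP.
by split; apply/principalP; [exists d|exists e]; rewrite addrAC -?bE -?aE.
Qed.

(** The ideal (x + y) contains (a) and is contained in (x) = (a). *)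
Lemma greenH_sandwich a x y : greenH a x -> principal (x + y) a ->
  greenH a (x + y).
Proof.
move=> /greenHP[/principalP[d ->] _] h; apply/greenHP; split=> //.
by apply/principalP; exists (d + y); rewrite addrA.
Qed.

(** Every element of H_a is a + d for some d, and H is a congruence, so testing c on a alone
    suffices. *)
Lemma StP a c : St a c <-> greenH a (c + a).
Proof.
split=> [|Hc x Hx]; first by apply.
apply: (etrans Hx); rewrite /Hclass/=.
have /greenHP[/principalP[d ->] _] := Hx.
by rewrite addrA; exact: greenH_addr.
Qed.

Lemma St_self a : St a a <-> greenH (a + a) a.
Proof. by rewrite StP; split=> /esym. Qed.

Lemma St_principal a x y : greenH a x -> principal (x + y) a -> St a y.
Proof.
move=> ax /(greenH_sandwich ax) h; apply/StP; apply: (etrans h).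
by rewrite [y + a]addrC; exact/esym/greenH_addr.
Qed.

Lemma St0 a : St a 0.
Proof. by apply/StP; rewrite add0r. Qed.

Lemma StD a c d : St a c -> St a d -> St a (c + d).
Proof. by move=> Sc Sd x /Sd/Sc; rewrite addrA. Qed.

Definition represents a (f : schutzenberger a) c :=
  St a c /\ forall x : Hclass a, val (val f x) = c + val x.

Lemma St_represents a c : St a c -> exists f : schutzenberger a, represents f c.
Proof.
move=> Sc.
pose f (x : Hclass a) : Hclass a :=
  exist _ (c + val x) (mem_set (Sc _ (set_mem (valP x)))).
have hf : is_translation f by apply/asboolP; exists c.
by exists (exist (@is_translation M a) f hf).
Qed.

Lemma represents_ex a (f : schutzenberger a) : exists c, represents f c.
Proof. by have /asboolP[c Sc fc] := valP f; exists c. Qed.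

Definition lift a (f : schutzenberger a) : M := projT1 (cid (represents_ex f)).

(** The class of c in Gamma. With the default 0 outside [St a], avoiding 0 and [tau a a] is plain
    zero-sum freeness when a does not stabilise H_a. *)
Definition tau a c : schutzenberger a :=
  if pselect (exists f, represents f c) is left h then projT1 (cid h) else 0.

Lemma liftP a (f : schutzenberger a) : represents f (lift f).
Proof. by rewrite /lift; case: cid. Qed.

Lemma tauP a c : St a c -> represents (tau a c) c.
Proof.
move=> /St_represents h; rewrite /tau.
by case: pselect => // h'; case: cid.
Qed.

Lemma tau_notSt a c : ~ St a c -> tau a c = 0.
Proof. by move=> Sc; rewrite /tau; case: pselect => // -[f []]. Qed.

Definition base a : Hclass a := exist _ a (mem_set erefl).

(** Gamma acts freely: each x in H_a is a + e, so its image is the image of a plus e. *)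
Lemma schutz_eval_inj a :
  injective (fun f : schutzenberger a => val (val f (base a))).
Proof.
move=> f g /=; have [c [_ fc]] := represents_ex f.
have [d [_ gd]] := represents_ex g; rewrite fc gd /= => cd.
apply: val_inj; apply/funext => x; apply: val_inj; rewrite fc gd.
have /greenHP[/principalP[e ->] _] := set_mem (valP x).
by rewrite !addrA cd.
Qed.

Lemma represents_inj a (f g : schutzenberger a) c :
  represents f c -> represents g c -> f = g.
Proof. by move=> [_ fc] [_ gc]; apply: schutz_eval_inj; rewrite /= fc gc. Qed.

Lemma represents0 a : represents (0 : schutzenberger a) 0.
Proof. by split=> [|x]; [exact: St0|rewrite add0r]. Qed.

Lemma representsD a (f g : schutzenberger a) c d :
  represents f c -> represents g d -> represents (f + g) (c + d).
Proof.
by move=> [Sc fc] [Sd gd]; split=> [|x]; [exact: StD|rewrite /= fc gd addrA].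
Qed.

Lemma represents_lift a (g : seq (schutzenberger a)) :
  represents (\sum_(f <- g) f) (\sum_(c <- map (@lift a) g) c).
Proof.
elim: g => [|f g IHg]; first by rewrite !big_nil; exact: represents0.
by rewrite !big_cons; apply: representsD => //; exact: liftP.
Qed.

Lemma represents_tau a (s : seq M) : (forall c, c \in s -> St a c) ->
  represents (\sum_(f <- map (tau a) s) f) (\sum_(c <- s) c).
Proof.
elim: s => [|c s IHs] Hs; first by rewrite !big_nil; exact: represents0.
rewrite !big_cons; apply: representsD; first by apply/tauP/Hs; rewrite mem_head.
by apply: IHs => d ds; apply: Hs; rewrite inE ds orbT.
Qed.

Lemma represents_zero a (f : schutzenberger a) c x :
  represents f c -> f = 0 -> greenH a x -> c + x = x.
Proof.
by move=> [_ fc] f0 ax; have := fc (exist _ x (mem_set ax)); rewrite f0.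
Qed.

Lemma represents_fix a (f : schutzenberger a) c :
  represents f c -> c + a = a -> f = 0.
Proof. by move=> [_ fc] ca; apply: schutz_eval_inj; rewrite /= fc. Qed.

Lemma Hclass_finiteP a (L : seq M) : (Hclass a `<=` [set` L])%classic ->
  forall g : seq (schutzenberger a), uniq g -> (size g <= size L)%N.
Proof.
move=> aL g ug.
rewrite -(size_map (fun f : schutzenberger a => val (val f (base a)))).
apply: uniq_leq_size; first by rewrite map_inj_uniq //; exact: schutz_eval_inj.
move=> _ /mapP[f fg ->]; apply: aL; exact: set_mem (valP (val f _)).
Qed.

(** The orbit map at a is onto: any x in H_a is a + c, and then c stabilises H_a. *)
Lemma infinite_Hclass a : infinite_set (Hclass a) ->
  infinite_set [set: schutzenberger a].
Proof.
move=> infH finG; apply: infH.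
apply: sub_finite_set
  (finite_image (fun f : schutzenberger a => val (val f (base a))) finG).
move=> x ax; have /greenHP[/principalP[c xE] _] := ax.
have Sc : St a c by apply/StP; rewrite addrC -xE.
by exists (tau a c) => //; have [_ ->] := tauP Sc; rewrite /= addrC.
Qed.

(* Each step picks a term that strictly shrinks the principal ideal, as long as
   one exists; if none does, congruence shows that y is already in H_a. *)
Lemma peel_chain a (s : seq M) y : a = y + \sum_(x <- s) x ->
  exists s1 s2 t, [/\ perm_eq s (s1 ++ s2), greenH a (y + \sum_(x <- s1) x),
    path (fun x y => `[< principal x `<` principal y >]) a t,
    principal (last a t) = principal y & size t = size s1].
Proof.
move: {2}(size s) (erefl (size s)) => n; elim: n s y => [|n IHn] s y.
  move=> /size0nil -> aE; exists [::], [::], [::].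
  by split=> //; rewrite aE !big_nil addr0 ?addr0.
move=> sz aE; have [[x xs xy]|nostep] :=
  pselect (exists2 x, x \in s & principal (y + x) `<` principal y); last first.
  exists [::], s, [::].
  have stay (r : seq M) : {subset r <= s} -> greenH y (y + \sum_(x <- r) x).
    elim: r => [|x r IHr] rs; first by rewrite big_nil addr0.
    have xs : x \in s by apply: rs; rewrite mem_head.
    rewrite big_cons addrA.
    have yx : greenH y (y + x).
      apply: contrapT => nyx; apply: nostep; exists x => //.
      have sub : principal (y + x) `<=` principal y.
        by apply/subset_principal; exists x.
      by split=> // yxs; apply: nyx; apply/seteqP.
    rewrite addrAC; apply: (etrans yx); apply: greenH_addr.
    by apply: IHr => z zr; apply: rs; rewrite inE zr orbT.
  have ya : greenH a y by rewrite /greenH aE; exact/esym/stay.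
  by split=> //; rewrite big_nil addr0.
have [] := IHn (rem x s) (y + x).
- by rewrite size_rem // sz.
- by rewrite -addrA; rewrite (perm_big _ (perm_to_rem xs)) big_cons in aE.
(* The chain obtained by induction ends at the ideal (y + x), strictly inside (y), so y goes on
   top. *)
move=> s1 [s2 [t [ps Ha tp tl tsz]]]; exists (x :: s1), s2, (rcons t y); split.
- by rewrite (perm_trans (perm_to_rem xs)) //= perm_cons.
- by rewrite big_cons addrA.
- by rewrite rcons_path tp; apply/asboolP; rewrite tl.
- by rewrite last_rcons.
- by rewrite size_rcons /= tsz.
Qed.

End GreenTheory.

(** * Zero-sum free sequences *)

(** For A = {0} these are the zero-sum free sequences; A = {0, [tau a a]} is the condition of the
    lower bound. *)
Definition avoids (G : zmodType) (A g : seq G) : Prop :=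
  forall w, subseq w g -> w != [::] -> \sum_(x <- w) x \notin A.

Section ZeroSumFree.
Variable G : zmodType.
Implicit Types (A g w : seq G) (l : nat).

Lemma avoids_nil A : avoids A [::].
Proof. by move=> w; rewrite subseq0 => ->. Qed.

Lemma avoids_perm A g g' : perm_eq g g' -> avoids A g -> avoids A g'.
Proof.
move=> pg Ag w /subseq_compl[v _ pv].
have [u ug pu] := perm_subseq (perm_trans pg pv).
move=> w0; rewrite -(perm_big _ pu); apply: Ag => //.
by rewrite -size_eq0 (perm_size pu) size_eq0.
Qed.

Lemma subseq_sums_finite g :
  exists L : seq G, forall w, subseq w g -> \sum_(x <- w) x \in L.
Proof.
elim: g => [|y g [L HL]].
  by exists [:: 0] => w; rewrite subseq0 => /eqP ->; rewrite big_nil mem_head.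
exists (L ++ map (+%R y) L) => -[|z w].
  by rewrite mem_cat HL ?sub0seq.
rewrite mem_cat /=; case: eqP => [->|_] wg; last by rewrite HL.
by rewrite big_cons map_f ?orbT // HL.
Qed.

Lemma infinite_avoids A l : infinite_set [set: G] ->
  exists2 g, size g = l & avoids A g.
Proof.
move=> infG; elim: l => [|l [g gl Ag]].
  by exists [::] => //; exact: avoids_nil.
have [L HL] := subseq_sums_finite g.
(* A new term x is bad only if x + s = t with t in A and s a subsequence sum of g, the empty sum
   included: finitely many values. *)
have [x xL] : exists x, x \notin [seq t - s | t <- A, s <- L].
  apply: contrapT => nx; apply: infG.
  apply: sub_finite_set (finite_seq [seq t - s | t <- A, s <- L]) => x _ /=.
  by apply: contrapT => /negP xL; apply: nx; exists x.
exists (x :: g); first by rewrite /= gl.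
move=> [|y w] //=; case: eqP => [->|_] wg _; last exact: Ag.
apply: contra xL; rewrite big_cons => xA.
by apply/allpairsP; exists (x + \sum_(z <- w) z, \sum_(z <- w) z);
  rewrite /= xA HL ?addrK.
Qed.

(* The partial sums of a zero-sum free sequence are pairwise distinct. *)
Lemma avoids0_size g l : avoids [:: 0] g ->
  (forall s : seq G, uniq s -> size s <= l)%N -> (size g < l)%N.
Proof.
move=> g0 bound.
(* Counting the empty one, there are [size g] + 1 partial sums, whence the strict bound. *)
rewrite -(size_mkseq (fun k => \sum_(x <- take k g) x) (size g).+1).
apply: bound; apply: contrapT => /negP /uniqPn => /(_ 0)[i [j [ij]]].
rewrite size_mkseq ltnS => jg.
rewrite !nth_mkseq //; last by rewrite ltnS ltnW // (leq_trans ij).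
rewrite -[in RHS](cat_take_drop i (take j g)) take_takel ?(ltnW ij) //.
rewrite big_cat /= => e; have s0 : \sum_(x <- drop i (take j g)) x = 0.
  by apply: (addrI (\sum_(x <- take i g) x)); rewrite -e addr0.
have := g0 (drop i (take j g)).
rewrite inE s0 eqxx => h; suff : false by []; apply: h.
  by rewrite (subseq_trans (drop_subseq _ _)) ?take_subseq.
by rewrite -size_eq0 size_drop size_takel // subn_eq0 -ltnNge.
Qed.

Lemma avoids_half l (t : G) :
  (forall g : seq G, avoids [:: 0%R] g -> size g < l)%N ->
  forall g : seq G, avoids [:: 0] g -> (size g).+1 = l ->
  exists2 h, avoids [:: 0; t] h & (l <= (size h).+1.*2)%N.
Proof.
move=> bound g g0 gl.
have [->|t0] := eqVneq t 0.
  exists g; last by rewrite gl -addnn leq_addr.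
  by move=> w wg /(g0 _ wg); rewrite !inE orbb.
(* If no part of g summed to t, then prepending -t would give a zero-sum free sequence of length
   l. *)
have [g1 g1g g1t] : exists2 w, subseq w g & \sum_(x <- w) x = t.
  apply: contrapT => nt; have := bound (- t :: g).
  rewrite /= gl ltnn => h; suff : false by []; apply: h.
  move=> [|y w] //=; case: eqP => [->|_] wg _; last exact: g0.
  rewrite big_cons inE addrC subr_eq0; apply/eqP => wt; apply: nt.
  by exists w.
have [g2 _ pg] := subseq_compl g1g.
case: g1 g1g g1t pg => [|x g1] g1g g1t pg;
  first by rewrite -g1t big_nil eqxx in t0.
have g2g : subseq g2 (x :: g1 ++ g2) := suffix_subseq (x :: g1) g2.
have {}g0 := avoids_perm pg g0.
(* With x split off, l is the sum of the sizes of g1 and g2 plus 2, so the longer one suffices. *)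
have : (l <= (size g1).+1.*2)%N \/ (l <= (size g2).+1.*2)%N.
  rewrite -gl (perm_size pg) /= size_cat -!addnn !addSn !addnS !ltnS.
  rewrite leq_add2l leq_add2r; case: (leqP (size g2) (size g1)) => [|/ltnW];
    by [left|right].
case=> le; [exists g1 => // w wg w0|
  exists (map -%R g2); rewrite ?size_map // => w].
  have wx : subseq w (x :: g1) := subseq_trans wg (subseq_cons _ _).
  rewrite !inE negb_or; apply/andP; split.
    have := g0 w; rewrite inE; apply => //.
    exact: subseq_trans wx (prefix_subseq _ _).
  have [v vg pv] := subseq_compl wg.
  (* As x :: g1 sums to t, a part w of g1 with sum t would leave x :: v with sum 0. *)
  apply/eqP => wt; have := g0 (x :: v).
  rewrite inE big_cons => h.
  have /h : subseq (x :: v) ((x :: g1) ++ g2).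
    by rewrite /= eqxx (subseq_trans vg) // prefix_subseq.
  suff -> : x + \sum_(z <- v) z = 0 by rewrite eqxx => /(_ isT).
  move: g1t; rewrite big_cons (perm_big _ pv) big_cat /= wt addrCA => /eqP.
  by rewrite eq_sym addrC -subr_eq subrr eq_sym => /eqP.
move=> /subseq_map_inv[v vg ->]; rewrite -size_eq0 size_map size_eq0 => v0.
rewrite big_map sumrN !inE oppr_eq0 negb_or; apply/andP; split.
  by have := g0 v; rewrite inE; apply => //; exact: subseq_trans vg g2g.
(* A part v of g2 with sum -t would cancel x :: g1. *)
apply/eqP => vt.
have : \sum_(y <- (x :: g1) ++ v) y \notin [:: 0].
  by apply: g0 => //; apply: cat_subseq.
by rewrite inE big_cat /= g1t -vt addNr eqxx.
Qed.

End ZeroSumFree.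

(** * Davenport constants *)

Section NatSup.
Variable R : realType.
Implicit Types (A : set nat) (n m : nat).

Lemma nat_sup_ubound A n : A n -> ((n%:R)%:E <= nat_sup R A)%E.
Proof. by move=> An; apply: ereal_sup_ubound; exists n. Qed.

Lemma nat_sup_max A m : A m -> (forall n, A n -> (n <= m)%N) ->
  nat_sup R A = (m%:R)%:E.
Proof.
move=> Am ub; apply/eqP; rewrite eq_le nat_sup_ubound // andbT.
by apply: ge_ereal_sup => _ [n /ub nm <-]; rewrite lee_fin ler_nat.
Qed.

Lemma nat_sup_bounded A b n : A n -> (forall n, A n -> (n <= b)%N) ->
  exists m, [/\ A m, forall n, A n -> (n <= m)%N & nat_sup R A = (m%:R)%:E].
Proof.
move=> An ub.
have exA : exists n, `[< A n >] by exists n; apply/asboolP.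
have ubA k : `[< A k >] -> (k <= b)%N by move=> /asboolP /ub.
case: (ex_maxnP exA ubA) => m /asboolP Am mmax.
have {}mmax k : A k -> (k <= m)%N by move=> Ak; apply/mmax/asboolP.
by exists m; split=> //; exact: nat_sup_max.
Qed.

Lemma nat_sup_fin_num A n : A n -> nat_sup R A \is a fin_num ->
  exists m, [/\ A m, forall n, A n -> (n <= m)%N & nat_sup R A = (m%:R)%:E].
Proof.
(* A finite supremum is below its truncation plus one, an integer bound for A. *)
move=> An fA; apply: (@nat_sup_bounded A (Num.truncn (fine (nat_sup R A))).+1 n An).
move=> k Ak; rewrite -(ler_nat R); have := nat_sup_ubound Ak.
rewrite -[leRHS](fineK fA) lee_fin => /le_trans; apply.
exact/ltW/truncnS_gt.
Qed.

Lemma nat_sup_unbounded A : (forall n, exists2 m, A m & (n <= m)%N) ->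
  nat_sup R A = +oo%E.
Proof.
move=> unb; have [m0 Am0 _] := unb 0%N.
have := @nat_sup_fin_num A m0 Am0; rewrite fin_numE.
have -> : nat_sup R A != -oo%E.
  by rewrite -ltNye (lt_le_trans _ (nat_sup_ubound Am0)) // ltNyr.
case: eqVneq => //= _ /(_ isT)[m [_ ub _]].
by have [k /ub km] := unb m.+1; rewrite ltnNge km.
Qed.

Lemma nat_inf_min A n : A n ->
  exists m, [/\ A m, forall n, A n -> (m <= n)%N & nat_inf R A = (m%:R)%:E].
Proof.
move=> An; have exA : exists n, `[< A n >] by exists n; apply/asboolP.
case: (ex_minnP exA) => m /asboolP Am mmin.
have {}mmin k : A k -> (m <= k)%N by move=> Ak; apply/mmin/asboolP.
exists m; split=> //; apply/eqP; rewrite eq_le; apply/andP; split.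
  by apply: ereal_inf_lbound; exists m.
by apply: le_ereal_inf_tmp => _ [k /mmin mk <-]; rewrite lee_fin ler_nat.
Qed.

End NatSup.

(** D is the least positive length that no zero-sum free sequence reaches; b is such a length, and
    minimality provides a zero-sum free sequence of length D - 1. *)
Lemma davenport_spec (R : realType) (G : zmodType) b : (0 < b)%N ->
  (forall s : seq G, uniq s -> size s <= b)%N ->
  exists D, [/\ (0 < D <= b)%N, davenport R G = (D%:R)%:E,
    forall g : seq G, avoids [:: 0%R] g -> (size g < D)%N &
    exists2 g : seq G, avoids [:: 0%R] g & (size g).+1 = D].
Proof.
move=> b0 bG; rewrite /davenport; set A := [set l | _].
have AP l : A l <-> (0 < l)%N /\
    forall g : seq G, avoids [:: 0%R] g -> (size g < l)%N.
  split=> -[l0 Al]; split=> //; [move=> g g0|move=> T lT].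
    rewrite ltnNge; apply/negP => lg.
    have [|T' [/msubset_seq_mset[w wg T'w] T'0 s0]] := Al (seq_mset g).
      by rewrite size_seq_mset.
    have := g0 w wg; rewrite inE -(perm_big _ T'w) s0 eqxx => h.
    suff : false by []; apply: h; apply/eqP => w0; apply: T'0.
    by apply/eqP; rewrite -size_mset_eq0 (perm_size T'w) w0.
  apply: contrapT => nT; have := Al T; rewrite ltnNge lT => h.
  suff : false by []; apply: h => w wT w0; rewrite inE.
  apply/eqP => s0; apply: nT; exists (seq_mset w); split.
  - rewrite -(seq_mset_id T); apply/msubset_seq_mset.
    by exists w => //; exact: perm_eq_seq_mset.
  - by move=> /(congr1 (fun A : {mset G} => size A)); apply/eqP;
      rewrite size_seq_mset size_mset0 size_eq0.
  - by rewrite (perm_big _ (perm_eq_seq_mset _)).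
have Ab : A b by apply/AP; split=> // g g0; exact: avoids0_size bG.
have [D [/AP[D0 HD] Dmin ->]] := nat_inf_min R Ab.
exists D; split; rewrite ?D0 ?Dmin //.
(* For D = 1 minimality says nothing, as 0 is not an admissible length; the empty sequence
   serves. *)
have [D1|D1] := posnP D.-1.
  by exists [::]; [exact: avoids_nil|rewrite /= -D1 prednK].
apply: contrapT => nD; suff /Dmin : A D.-1 by rewrite leqNgt ltn_predL D0.
apply/AP; split=> // g g0; have := HD g g0.
rewrite -{1}(prednK D0) ltnS leq_eqVlt => /orP[/eqP gD|//].
by case: nD; exists g; rewrite // gD prednK.
Qed.

Lemma to_adjoin0_inv (S : addSemigroupType) (u : adjoin0 S) :
  u <> 0 -> exists x, u = to_adjoin0 x.
Proof.
case: u => -[x|] hu u0; first by exists x; exact: val_inj.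
case: u0; apply: val_inj; rewrite /= /opt_zero; case: pselect => // h.
by have /asboolP := hu.
Qed.

Lemma to_adjoin0_seq (S : addSemigroupType) (s : seq (adjoin0 S)) :
  0 \notin s -> exists t, s = map (@to_adjoin0 S) t.
Proof.
elim: s => [|u s IHs]; first by exists [::].
rewrite inE negb_or eq_sym => /andP[/eqP/to_adjoin0_inv[x ->] /IHs[t ->]].
by exists (x :: t).
Qed.

(** * Lengths of irreducible sequences of sum a *)

Section Bounds.
Variables (S : addSemigroupType) (a : adjoin0 S).
Hypothesis a0 : a <> 0.
Local Notation G := (schutzenberger a).

(* The sequence is b, c_1, .., c_n, where the c_i represent g and b completes
   the sum to a; a proper subsequence of sum a would either miss a nonempty
   zero-sum part of g, or be a nonempty part of g representing tau a. *)
Lemma avoids_irreducible (g : seq G) : avoids [:: 0; tau a a] g ->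
  exists2 T : {mset S}, irreducible T /\ seq_sum T = a & size T = (size g).+1.
Proof.
move=> Ag; have /= [Sc gc] := represents_lift g.
set c := map (@lift _ a) g in Sc gc *.
(* The sum of c stabilises H_a, so a is that sum plus a + d; this gives the completing term b. *)
have /StP/greenHP[_ /principalP[d aE]] := Sc.
set b := a + d; have bE : b + \sum_(x <- c) x = a.
  by rewrite /b (addrAC a d) (addrC a) -aE.
(* If lifts of a nonempty part of g summed to a, then a would stabilise H_a and that part would sum
   to [tau a a]. *)
have c_a w : subseq w c -> w != [::] -> \sum_(x <- w) x <> a.
  move=> /subseq_map_inv[v vg ->] v0 va.
  have rv := represents_lift v; rewrite va in rv.
  have := Ag v vg; rewrite -size_eq0 -(size_map (@lift _ a)) size_eq0 => /(_ v0).
  by rewrite !inE (represents_inj rv (tauP rv.1)) eqxx orbT.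
(* The terms must come from S. If b were 0, c would sum to a; if a lift were 0, its class would be a
   zero term of g. *)
have bc0 : 0 \notin b :: c.
  rewrite inE negb_or; apply/andP; split.
    apply/eqP => b0; move: bE; rewrite -b0 add0r.
    have [c0|c0] := eqVneq c [::]; last exact: c_a.
    by rewrite c0 big_nil => /esym.
  apply/mapP => -[f fg f0]; have := Ag [:: f]; rewrite sub1seq fg => /(_ isT isT).
  have := liftP f; rewrite -f0 big_seq1 !inE.
  by move=> /represents_fix ->; rewrite ?eqxx ?add0r.
have [t tE] := to_adjoin0_seq bc0.
have ta : seq_sum (seq_mset t) = a by rewrite seq_sum_seq_mset -tE big_cons.
have tsz : size t = (size g).+1.
  by rewrite -(size_map (@to_adjoin0 S)) -tE /= size_map.
exists (seq_mset t); last by rewrite size_seq_mset.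
split=> //; apply/(irreducibleP a0 ta) => w; rewrite -tE tsz.
case: w => [|x w]; first by rewrite big_nil => _ /esym.
rewrite [subseq _ _]/=; case: eqP => [->|_]; last by move=> /c_a /(_ isT).
move=> /subseq_map_inv[v vg ->]; rewrite big_cons => va.
rewrite /= ltnS size_map; have [u ug pu] := subseq_compl vg.
have [u0|u0] := eqVneq u [::]; first by rewrite (perm_size pu) u0 cats0.
have := Ag u ug u0; rewrite !inE.
rewrite (represents_fix (represents_lift u)) ?eqxx //.
rewrite -[in RHS]bE /c (perm_big _ (perm_map _ pu)) map_cat big_cat /= addrA va.
by rewrite addrC.
Qed.

Lemma irreducible_size (p D : nat) (T : {mset S}) :
  (forall t, path (fun x y => `[< principal x `<` principal y >]) a t ->
    (size t <= p)%N) ->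
  (forall g : seq G, avoids [:: 0] g -> (size g < D)%N) ->
  irreducible T -> seq_sum T = a -> (size T < p + D)%N.
Proof.
rewrite -(seq_mset_id T); move: (enum_mset T) => s Hp HD irr sa.
have {}irr := (irreducibleP a0 sa).1 irr.
rewrite size_seq_mset -(size_map (@to_adjoin0 S)).
rewrite seq_sum_seq_mset in sa; rewrite -(size_map (@to_adjoin0 S)) in irr.
move: (map _ s) irr sa => {}s irr sa.
(* Peeling from the empty sum 0 gives a chain above (a) as long as s1, so s1 has at most p terms. *)
have [|s1 [s2 [t [ps as1 tp _ tsz]]]] := @peel_chain _ a s 0.
  by rewrite add0r sa.
rewrite add0r in as1.
rewrite (perm_size ps) size_cat -tsz -addnS leq_add ?Hp // ?HD //.
rewrite -(size_map (tau a)); apply: HD => w /subseq_map_inv[v vs2 ->] v0.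
have [u us2 pu] := subseq_compl vs2.
rewrite inE; apply/eqP => tv0.
have aE : a = \sum_(x <- s1) x + \sum_(x <- v) x + \sum_(x <- u) x.
  by rewrite -[LHS]sa (perm_big _ ps) big_cat /= (perm_big _ pu) big_cat addrA.
(* In Green's preorder s1 + u lies between a and s1, hence in H_a, where v acts trivially: dropping
   v keeps the sum a. *)
have Hu : greenH a (\sum_(x <- s1) x + \sum_(x <- u) x).
  apply: greenH_sandwich as1 _; apply/principalP.
  by exists (\sum_(x <- v) x); rewrite addrAC.
have Ss2 x : x \in s2 -> St a x.
  move=> xs2; apply: St_principal as1 _; apply/principalP.
  exists (\sum_(y <- rem x s2) y); rewrite -addrA -[LHS]sa (perm_big _ ps).
  by rewrite big_cat /= (perm_big _ (perm_to_rem xs2)) big_cons.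
have Sv x : x \in v -> St a x by move=> /(mem_subseq vs2)/Ss2.
have := represents_zero (represents_tau Sv) tv0 Hu.
rewrite addrC addrAC -aE => us1.
have [r rs pr] : exists2 r, subseq r s & perm_eq r (s1 ++ u).
  apply: (@perm_subseq _ _ _ v); rewrite (perm_trans ps) //.
  by rewrite -catA perm_cat2l (perm_trans pu) // perm_catC.
have := irr r rs; rewrite (perm_big _ pr) big_cat /= -us1 => /(_ erefl).
rewrite (perm_size ps) (perm_size pr) !size_cat (perm_size pu) size_cat.
by rewrite leq_add2l -[X in (_ <= X)%N]add0n leq_add2r leqn0 size_eq0; case: (v) v0.
Qed.

End Bounds.

(** * From bounds on lengths to extended real values *)

Section Values.
Variable R : realType.

Lemma Psi_bounded (M : nmodType) (a : M) b :
  (forall t, path (fun x y => `[< principal x `<` principal y >]) a t ->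
    (size t <= b)%N) ->
  Psi R a \is a fin_num /\ exists2 p, (p <= b)%N & Psi R a = (p%:R)%:E.
Proof.
move=> Hb; rewrite /Psi; set A := [set _ | _ in _].
have A0 : A 0%N by exists [::].
have [_ [t /Hb tb <-]|p [Ap _ ->]] := @nat_sup_bounded R A b 0 A0; first exact: tb.
by split=> //; exists p => //; case: Ap => t /Hb tb <-.
Qed.

Lemma Psi_fin_num (M : nmodType) (a : M) : Psi R a \is a fin_num ->
  exists2 p, Psi R a = (p%:R)%:E &
    forall t, path (fun x y => `[< principal x `<` principal y >]) a t ->
      (size t <= p)%N.
Proof.
move=> fP; have [|p [_ ub pE]] := nat_sup_fin_num _ fP (n := 0%N).
  by exists [::].
by exists p => // t ta; apply: ub; exists t.
Qed.

Variables (S : addSemigroupType) (a : adjoin0 S).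
Hypothesis a0 : a <> 0.

Lemma davenport_at_infinite : infinite_set (Hclass a) ->
  davenport_at R a = +oo%E.
Proof.
move=> /infinite_Hclass infG; apply: nat_sup_unbounded => n.
have [g gn Ag] := infinite_avoids [:: 0; tau a a] n infG.
have [T aT Tg] := avoids_irreducible a0 Ag.
by exists (size T); [exists T|rewrite Tg gn].
Qed.

(** The bounds are stated in natural numbers, with [m.*2] standing for the factor 1/2; D <= [size L]
    pins D down in the examples. *)
Lemma davenport_at_finite (L : seq (adjoin0 S)) :
  Psi R a \is a fin_num -> Hclass a `<=` [set` L] ->
  exists p D m, [/\ Psi R a = (p%:R)%:E,
    davenport R (schutzenberger a) = (D%:R)%:E,
    davenport_at R a = (m%:R)%:E,
    (0 < D <= size L)%N &
    (m < p + D)%N /\ (D <= if `[< greenH (a + a) a >] then m.*2 else m)%N].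
Proof.
move=> /Psi_fin_num[p pE pub] aL.
have L0 : (0 < size L)%N by case: L aL => // /(_ a erefl).
have [D [DL DE D0 [g g0 gD]]] := davenport_spec R L0 (Hclass_finiteP aL).
(* The empty sequence over Gamma yields a one-term irreducible sequence, so the supremum runs over a
   nonempty set. *)
have [T0 T0a _] := avoids_irreducible a0 (avoids_nil _).
set A := [set size T | T in [set T : {mset S} | irreducible T /\ seq_sum T = a]].
have AT0 : A (size T0) by exists T0.
have Aub n : A n -> (n < p + D)%N.
  by move=> [T [irr sa] <-]; exact: irreducible_size irr sa.
have [m [Am mub mE]] := nat_sup_bounded R AT0 (fun n An => ltnW (Aub n An)).
have Alb h : avoids [:: 0; tau a a] h -> (size h < m)%N.
  by move=> /(avoids_irreducible a0)[T Ta <-]; apply: mub; exists T.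
exists p, D, m; split=> //; split; first exact: Aub.
case: asboolP => [_|na].
  have [h Ah /leq_trans] := avoids_half (tau a a) D0 g0 gD.
  by apply; rewrite leq_double Alb.
(* Here a does not stabilise H_a, so [tau a a] is the default 0 and zero-sum freeness of g
   suffices. *)
rewrite -gD; apply: Alb => w wg /(g0 w wg).
by rewrite tau_notSt ?St_self // !inE orbb.
Qed.

End Values.

Lemma EFin_natB1 (R : realType) (p D : nat) :
  ((p%:R)%:E + (D%:R)%:E - 1 = ((p + D)%:R - 1)%:E :> \bar R)%E.
Proof. by rewrite natrD. Qed.

(** * Sharpness *)

Lemma adjoin0_of_identity (S : addSemigroupType) (u : adjoin0 S) :
  has_identity S -> exists x, u = to_adjoin0 x.
Proof.
case: u => -[x|] hu S0; first by exists x; exact: val_inj.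
by have /asboolP := hu.
Qed.

Section Group.
Variable V : zmodType.

Lemma adjoin0_zmodP (u : adjoin0 V) : exists x, u = to_adjoin0 x.
Proof. by apply: adjoin0_of_identity; exists 0; exact: add0r. Qed.

Lemma zmod_principal (u v : adjoin0 V) : principal u v.
Proof.
have [[x ->] [y ->]] := (adjoin0_zmodP u, adjoin0_zmodP v).
by exists (to_adjoin0 (y - x)) => //; rewrite -to_adjoin0D addrC subrK.
Qed.

Lemma zmod_Psi (a : adjoin0 V) t :
  path (fun x y => `[< principal x `<` principal y >]) a t -> (size t <= 0)%N.
Proof.
case: t => //= x t /andP[/asboolP[_ nxa] _]; case: nxa => y _.
exact: zmod_principal.
Qed.

End Group.

Lemma adjoin0_natP (u : adjoin0 nat) : exists n : nat, u = to_adjoin0 n.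
Proof. by apply: adjoin0_of_identity; exists 0%N; exact: add0n. Qed.

Lemma principal_nat (m n : nat) :
  principal (to_adjoin0 m) (to_adjoin0 n) <-> (m <= n)%N.
Proof.
split=> [[c _]|mn].
  by have [k ->] := adjoin0_natP c => -[<-]; exact: leq_addr.
by exists (to_adjoin0 (n - m)%N) => //; apply: val_inj; congr Some; exact: subnKC.
Qed.

(** Ideals of N are ordered by reversed size of the generator, so only (0) lies strictly above
    (1). *)
Lemma nat_Psi t :
  path (fun x y => `[< principal x `<` principal y >]) (to_adjoin0 1%N) t ->
  (size t <= 1)%N.
Proof.
case: t => [|x [|y t]] //= /and3P[/asboolP[ax nxa] /asboolP[xy nyx] _].
have [n xE] := adjoin0_natP x; have [k yE] := adjoin0_natP y; subst x y.
move: ax nxa xy nyx; rewrite !subset_principal !principal_nat.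
by case: n => [|[|n]] // _ _ _; case.
Qed.

Lemma nat_Hclass : Hclass (to_adjoin0 1%N) `<=` [set` [:: to_adjoin0 1%N]].
Proof.
move=> x /greenHP; have [n ->] := adjoin0_natP x; rewrite !principal_nat => -[].
by case: n => [|[|n]] // _ _; rewrite /= mem_head.
Qed.

Lemma nat_not_greenH :
  ~ greenH (to_adjoin0 1%N + to_adjoin0 1%N) (to_adjoin0 1%N).
Proof. by rewrite -to_adjoin0D => /greenHP[]; rewrite principal_nat. Qed.

Local Open Scope ereal_scope.

Theorem theorem1p2 (R : realType) :
  (forall (S : addSemigroupType) (a : adjoin0 S),
     a <> 0%R -> Psi R a \is a fin_num ->
     (infinite_set (Hclass a) -> davenport_at R a = +oo) /\
     (finite_set (Hclass a) ->
        [/\ davenport_at R a \is a fin_num,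
            (epsilon R a)%:E * davenport R (schutzenberger a)
              <= davenport_at R a &
            davenport_at R a
              <= Psi R a + davenport R (schutzenberger a) - 1])) /\
  [/\ exists (S : addSemigroupType) (a : adjoin0 S),
        [/\ a <> 0%R, Psi R a \is a fin_num, finite_set (Hclass a),
            greenH (a + a)%R a &
            davenport_at R a
              = (epsilon R a)%:E * davenport R (schutzenberger a)],
      exists (S : addSemigroupType) (a : adjoin0 S),
        [/\ a <> 0%R, Psi R a \is a fin_num, finite_set (Hclass a),
            ~ greenH (a + a)%R a &
            davenport_at R a
              = (epsilon R a)%:E * davenport R (schutzenberger a)] &
      exists (S : addSemigroupType) (a : adjoin0 S),
        [/\ a <> 0%R, Psi R a \is a fin_num, finite_set (Hclass a) &
            davenport_at R a
              = Psi R a + davenport R (schutzenberger a) - 1]].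
Proof.
have nat0 : to_adjoin0 1%N <> 0%R by move=> /to_adjoin0_eq0 /(_ 0%N).
have [nat_fin [p p1 pE]] := Psi_bounded R nat_Psi.
have nat_finH := sub_finite_set nat_Hclass (finite_seq _).
have [q [D [m [qE DE mE D1 [mq]]]]] := davenport_at_finite nat0 nat_fin nat_Hclass.
have [/nat_not_greenH[]|ng Dm] := asboolP.
have {}D1 : D = 1%N by case: D D1 {DE mq Dm} => [|[|]].
have qp : q = p by apply/eqP; rewrite -(eqr_nat R) -eqe -qE -pE.
(* Now 1 = D <= m <= p <= 1, so in N both bounds equal 1. *)
have [m1 {}p1] : m = 1%N /\ p = 1%N.
  move: mq Dm; rewrite D1 qp addn1 ltnS => mp m1; split; apply/anti_leq.
    by rewrite m1 (leq_trans mp).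
  by rewrite p1 (leq_trans m1).
split; last split.
- move=> S a a0 fP; split; first exact: davenport_at_infinite.
  move=> /finite_seqP[L aL].
  have [|p' [D' [m' [-> -> -> /andP[D'0 _] [mpD Dm']]]]] :=
    davenport_at_finite (L := L) a0 fP.
    by rewrite aL.
  split=> //.
    rewrite -EFinM lee_fin /epsilon; case: asboolP Dm' => _ Dm'.
      by rewrite mulrC ler_pdivrMr // -natrM ler_nat muln2.
    by rewrite mul1r ler_nat.
  by rewrite EFin_natB1 lee_fin lerBrDr -(natrD _ _ 1) ler_nat addn1.
(* In Z/2 the chain length is 0 and D <= 2, so m < D <= 2m leaves only m = 1 and D = 2. *)
- pose a := @to_adjoin0 'Z_2 1%R.
  have a0 : a <> 0%R by move=> /to_adjoin0_eq0 /(_ 0%R).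
  have [fP [r r0 rE]] := Psi_bounded R (@zmod_Psi _ a).
  have aL : Hclass a `<=` [set` map (@to_adjoin0 'Z_2) (enum 'Z_2)].
    move=> u _ /=; have [x ->] := adjoin0_zmodP u.
    by rewrite map_f // mem_enum.
  have aa : greenH (a + a)%R a by apply/greenHP; split; exact: zmod_principal.
  exists 'Z_2, a; split=> //; first exact: sub_finite_set aL (finite_seq _).
  have [p' [D' [m' [pE' -> -> D2 [mpD Dm']]]]] := davenport_at_finite a0 fP aL.
  move: pE' D2 mpD Dm'; rewrite rE size_map -cardE card_ord asboolT //.
  move=> [/eqP]; rewrite eqr_nat => /eqP <-.
  move: r0; rewrite leqn0 => /eqP ->; rewrite add0n => D2 mD Dm2.
  rewrite -EFinM /epsilon asboolT //; congr EFin.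
  case: D' m' D2 mD Dm2 => [|[|[|D']]] [|[|m']] //= _ _ _.
  by rewrite mulVf // pnatr_eq0.
- exists nat, (to_adjoin0 1%N); split=> //.
  by rewrite mE DE /epsilon asboolF // D1 m1 -EFinM mul1r.
- exists nat, (to_adjoin0 1%N); split=> //.
  by rewrite mE pE DE D1 m1 p1 EFin_natB1 natrD addrK.
Qed.
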